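(* Let $H$ and $K$ be Hilbert $\mathfrak{A}$-modules over a $C^*$-algebra $\mathfrak{A}$, let $M\in\mathcal{L}(K)$ and $N\in\mathcal{L}(H)$ be weights, and let $A\in\mathcal{L}(H,K)$ be such that $A^\dag_{MN}$ exists. Then the operators $$T_{A,N}=A^\dag A+N(I_H-A^\dag A)N\in\mathcal{L}(H),\qquad S_{A,M}=\left[AA^\dag+M^{-1}(I_K-AA^\dag)M^{-1}\right]^{-1}\in\mathcal{L}(K)$$ are well defined and positive definite, and $$A^\dag_{MN}=A^\dag_{S_{A,M}T_{A,N}}.$$
   Context: $\mathcal{L}(H,K)$ is the set of adjointable operators from $H$ to $K$, $\mathcal{L}(H)=\mathcal{L}(H,H)$, and $I_H$ is the identity operator on $H$. A weight on $K$ is an operator $M\in\mathcal{L}(K)$ with $M=M^*$ that is invertible in $\mathcal{L}(K)$ (it need not be positive); a positive definite operator is a weight that is moreover positive. For weights $M\in\mathcal{L}(K)$, $N\in\mathcal{L}(H)$ and $A\in\mathcal{L}(H,K)$, the weighted Moore-Penrose inverse $A^\dag_{MN}$ (if it exists) is the (necessarily unique) element $X\in\mathcal{L}(K,H)$ satisfying $AXA=A$, $XAX=X$, $(MAX)^*=MAX$, $(NXA)^*=NXA$. The Moore-Penrose inverse is $A^\dag=A^\dag_{I_K I_H}$; it exists whenever $A^\dag_{MN}$ exists for some weights $M,N$. *)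

(* Defs.v *)
From HB Require Import structures.
From mathcomp Require Import all_boot all_order all_algebra.
From mathcomp Require Import complex.
From mathcomp Require Import all_classical all_reals all_analysis.

Set Implicit Arguments.
Unset Strict Implicit.
Unset Printing Implicit Defensive.

Import Order.TTheory GRing.Theory Num.Theory.
Import numFieldNormedType.Exports.

Local Open Scope classical_set_scope.
Local Open Scope complex_scope.
Local Open Scope ring_scope.

(* Complex C*-algebras, not assumed unital (hence the multiplication is not
   inherited from a MathComp ring, which would have a unit).  The norm of a
   normed module over R[i] takes values in R[i]. *)
HB.mixin Record isCStarAlgebra (R : realType) A
    of CompleteNormedModule R[i] A := {
  cmul : A -> A -> A ;
  cstar : A -> A ;
  cmulA : associative cmul ;
  cmulDl : left_distributive cmul +%R ;
  cmulDr : right_distributive cmul +%R ;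
  cmulZl : forall (c : R[i]) (a b : A), cmul (c *: a) b = c *: cmul a b ;
  cmulZr : forall (c : R[i]) (a b : A), cmul a (c *: b) = c *: cmul a b ;
  cnormM : forall a b : A, `|cmul a b| <= `|a| * `|b| ;
  cstarK : involutive cstar ;
  cstarD : {morph cstar : a b / a + b} ;
  cstarZ : forall (c : R[i]) (a : A), cstar (c *: a) = c^*%C *: cstar a ;
  cstarM : forall a b : A, cstar (cmul a b) = cmul (cstar b) (cstar a) ;
  cnorm_star : forall a : A, `|cmul (cstar a) a| = `|a| ^+ 2
}.

#[short(type="cstarAlgType")]
HB.structure Definition CStarAlgebra (R : realType) :=
  {A of CompleteNormedModule R[i] A & isCStarAlgebra R A}.

Definition cpositive (R : realType) (A : cstarAlgType R) (a : A) : Prop :=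
  exists b : A, a = cmul (cstar b) b.

(* Right Hilbert modules; the inner product is linear in its second argument.
   As the norm is required to be the one induced by the inner product,
   completeness is inherited from CompleteNormedModule. *)
HB.mixin Record isHilbertModule (R : realType) (A : cstarAlgType R) H
    of CompleteNormedModule R[i] H := {
  ract : H -> A -> H ;
  inner : H -> H -> A ;
  ractDl : forall (x y : H) (a : A), ract (x + y) a = ract x a + ract y a ;
  ractDr : forall (x : H) (a b : A), ract x (a + b) = ract x a + ract x b ;
  ractM : forall (x : H) (a b : A), ract x (cmul a b) = ract (ract x a) b ;
  ractZl : forall (c : R[i]) (x : H) (a : A), ract (c *: x) a = c *: ract x a ;
  ractZr : forall (c : R[i]) (x : H) (a : A), ract x (c *: a) = c *: ract x a ;
  innerDr : forall x y z : H, inner x (y + z) = inner x y + inner x z ;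
  innerZr : forall (c : R[i]) (x y : H), inner x (c *: y) = c *: inner x y ;
  inner_ract : forall (x y : H) (a : A),
    inner x (ract y a) = cmul (inner x y) a ;
  inner_star : forall x y : H, cstar (inner x y) = inner y x ;
  inner_ge0 : forall x : H, cpositive (inner x x) ;
  inner_eq0 : forall x : H, inner x x = 0 -> x = 0 ;
  hnormE : forall x : H, `|x| ^+ 2 = `|inner x x|
}.

#[short(type="hilbertModType")]
HB.structure Definition HilbertModule (R : realType) (A : cstarAlgType R) :=
  {H of CompleteNormedModule R[i] H & isHilbertModule R A H}.

Section InnerTheory.
Context {R : realType} {A : cstarAlgType R} {H : hilbertModType A}.

Lemma inner_lin0r (x : H) : inner x 0 = 0.
Proof. by rewrite -(scale0r 0) innerZr scale0r. Qed.

Lemma inner_oppr (x y : H) : inner x (- y) = - inner x y.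
Proof. by rewrite -scaleN1r innerZr scaleN1r. Qed.

Lemma cstar0 : cstar (0 : A) = 0.
Proof. by apply: (addIr (cstar 0)); rewrite -cstarD !add0r. Qed.

Lemma cstarN (a : A) : cstar (- a) = - cstar a.
Proof. by apply: (addIr (cstar a)); rewrite -cstarD !addNr cstar0. Qed.

Lemma inner_addl (x y z : H) : inner (x + y) z = inner x z + inner y z.
Proof. by rewrite -inner_star innerDr cstarD !inner_star. Qed.

Lemma inner_oppl (x y : H) : inner (- x) y = - inner x y.
Proof. by rewrite -inner_star inner_oppr cstarN inner_star. Qed.

Lemma inner_lin0l (x : H) : inner 0 x = 0.
Proof. by rewrite -inner_star inner_lin0r cstar0. Qed.

Lemma inner_inj (y z : H) : (forall x, inner x y = inner x z) -> y = z.
Proof.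
move=> yz; apply/eqP; rewrite -subr_eq0; apply/eqP/inner_eq0.
by rewrite innerDr inner_oppr yz subrr.
Qed.

End InnerTheory.

(* The adjoint is determined by the operator (lemma adjointable_ext), so
   recording it is no extra structure: this type is the set of the maps
   H -> K that have an adjoint.  Such maps are automatically A-linear and
   bounded. *)
Record adjointable (R : realType) (A : cstarAlgType R)
    (H K : hilbertModType A) := Adjointable {
  opfun :> H -> K ;
  opadj : K -> H ;
  opadjP : forall (x : H) (y : K), inner (opfun x) y = inner x (opadj y)
}.

Section AdjointableOps.
Context {R : realType} {A : cstarAlgType R}.
Implicit Types H K L : hilbertModType A.

Lemma adjointable_ext H K (S T : adjointable H K) : S =1 T -> S = T.
Proof.
case: S T => [s s' sP] [t t' tP] /= /funext st; subst t.
have st' : s' = t'.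
  by apply/funext => y; apply: inner_inj => x; rewrite -sP -tP.
by subst t'; congr Adjointable; exact: Prop_irrelevance.
Qed.

Lemma opadj_sym H K (T : adjointable H K) (y : K) (x : H) :
  inner (opadj T y) x = inner y (T x).
Proof. by rewrite -inner_star -opadjP inner_star. Qed.

Definition adjop H K (T : adjointable H K) : adjointable K H :=
  Adjointable (opadj_sym T).

Fact idop_subproof H (x y : H) : inner (id x) y = inner x (id y).
Proof. by []. Qed.

Definition idop H : adjointable H H := Adjointable (@idop_subproof H).

Fact compop_subproof H K L (S : adjointable K L) (T : adjointable H K) x y :
  inner ((S \o T) x) y = inner x ((opadj T \o opadj S) y).
Proof. by rewrite /= !opadjP. Qed.

Definition compop H K L (S : adjointable K L) (T : adjointable H K) :
  adjointable H L := Adjointable (compop_subproof S T).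

Fact zeroop_subproof H K (x : H) (y : K) :
  inner ((fun _ => 0 : K) x) y = inner x ((fun _ => 0 : H) y).
Proof. by rewrite inner_lin0l inner_lin0r. Qed.

Definition zeroop H K : adjointable H K := Adjointable (@zeroop_subproof H K).

Fact addop_subproof H K (S T : adjointable H K) x y :
  inner ((fun x => S x + T x) x) y
  = inner x ((fun y => opadj S y + opadj T y) y).
Proof. by rewrite inner_addl innerDr !opadjP. Qed.

Definition addop H K (S T : adjointable H K) : adjointable H K :=
  Adjointable (addop_subproof S T).

Fact oppop_subproof H K (T : adjointable H K) x y :
  inner ((fun x => - T x) x) y = inner x ((fun y => - opadj T y) y).
Proof. by rewrite inner_oppl inner_oppr opadjP. Qed.

Definition oppop H K (T : adjointable H K) : adjointable H K :=
  Adjointable (oppop_subproof T).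

HB.instance Definition _ H K := gen_eqMixin (adjointable H K).
HB.instance Definition _ H K := gen_choiceMixin (adjointable H K).

Fact addopA H K : associative (@addop H K).
Proof. by move=> S T U; apply: adjointable_ext => x /=; rewrite addrA. Qed.

Fact addopC H K : commutative (@addop H K).
Proof. by move=> S T; apply: adjointable_ext => x /=; rewrite addrC. Qed.

Fact add0op H K : left_id (zeroop H K) (@addop H K).
Proof. by move=> T; apply: adjointable_ext => x /=; rewrite add0r. Qed.

Fact addNop H K : left_inverse (zeroop H K) (@oppop H K) (@addop H K).
Proof. by move=> T; apply: adjointable_ext => x /=; rewrite addNr. Qed.

HB.instance Definition _ H K := GRing.isZmodule.Build (adjointable H K)
  (@addopA H K) (@addopC H K) (@add0op H K) (@addNop H K).

End AdjointableOps.

Arguments idop {R A} H.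

Declare Scope op_scope.
Delimit Scope op_scope with op.
Notation "''L' ( H , K )" := (adjointable H K)
  (at level 8, format "''L' ( H ,  K )") : type_scope.
Notation "''L' ( H )" := (adjointable H H)
  (at level 8, format "''L' ( H )") : type_scope.
Infix "**" := compop (at level 40, left associativity) : op_scope.
Notation "T ^**" := (adjop T) (at level 8, format "T ^**") : op_scope.

Local Open Scope op_scope.

Section MoorePenrose.
Context {R : realType} {A : cstarAlgType R}.
Implicit Types H K : hilbertModType A.

Definition is_opinv H (T S : 'L(H)) : Prop :=
  T ** S = idop H /\ S ** T = idop H.

Definition op_invertible H (T : 'L(H)) : Prop := exists S : 'L(H), is_opinv T S.

(* the inverse of T if T is invertible in 'L(H), and 0 otherwise *)
Definition opinv H (T : 'L(H)) : 'L(H) := xget 0 [set S | is_opinv T S].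

Definition weight H (T : 'L(H)) : Prop := T^** = T /\ op_invertible T.

Definition op_positive H (T : 'L(H)) : Prop :=
  forall x : H, cpositive (inner x (T x)).

Definition positive_definite H (T : 'L(H)) : Prop :=
  weight T /\ op_positive T.

Definition is_wmpinv H K (M : 'L(K)) (N : 'L(H)) (T : 'L(H, K))
    (X : 'L(K, H)) : Prop :=
  [/\ T ** X ** T = T,
      X ** T ** X = X,
      (M ** T ** X)^** = M ** T ** X &
      (N ** X ** T)^** = N ** X ** T].

Definition has_wmpinv H K (M : 'L(K)) (N : 'L(H)) (T : 'L(H, K)) : Prop :=
  exists X : 'L(K, H), is_wmpinv M N T X.

(* the weighted Moore-Penrose inverse if it exists, and 0 otherwise *)
Definition wmpinv H K (M : 'L(K)) (N : 'L(H)) (T : 'L(H, K)) : 'L(K, H) :=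
  xget 0 [set X | is_wmpinv M N T X].

Definition has_mpinv H K (T : 'L(H, K)) : Prop :=
  has_wmpinv (idop K) (idop H) T.

Definition mpinv H K (T : 'L(H, K)) : 'L(K, H) := wmpinv (idop K) (idop H) T.

Definition Tweight H K (T : 'L(H, K)) (N : 'L(H)) : 'L(H) :=
  mpinv T ** T + N ** (idop H - mpinv T ** T) ** N.

Definition Sweight_inv H K (T : 'L(H, K)) (M : 'L(K)) : 'L(K) :=
  T ** mpinv T + opinv M ** (idop K - T ** mpinv T) ** opinv M.

Definition Sweight H K (T : 'L(H, K)) (M : 'L(K)) : 'L(K) :=
  opinv (Sweight_inv T M).

End MoorePenrose.

(* Main.v *)
From HB Require Import structures.
Require Import Defs.
From mathcomp Require Import all_boot all_order all_algebra.
From mathcomp Require Import complex.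
From mathcomp Require Import all_classical all_reals all_analysis.
From mathcomp Require Import ring lra.

(* Write X for A^+_MN and D for A^+.  The idempotents F = XA and P = DA have the
   same kernel, so PF = P and FP = F, while NF = F^*N.  These relations alone
   give T_{A,N} = R^*R with R = P + (1 - P)N, R^-1 = F + (1 - F)N^-1, and
   T_{A,N} F = P; positivity of T_{A,N} is thus that of <Rx, Rx>.  The inverse
   of S_{A,M} is the same construction for the weight M^-1, the projection
   AD and the idempotent (AX)^*.
   Existence of D needs a self-adjoint projection with the same kernel as F, hence
   the invertibility of 1 + B for the skew-adjoint B = F - F^*.  This follows
   from a Neumann series for (s - B)/(1 + s) with s large.  Only a
   Cauchy-Schwarz inequality up to a constant is used, so that no order on the
   C*-algebra is needed; boundedness of adjointable maps is by a gliding
   hump. *)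

Set Implicit Arguments.
Unset Strict Implicit.
Unset Printing Implicit Defensive.

Import Order.TTheory GRing.Theory Num.Theory.
Import numFieldNormedType.Exports.

Local Open Scope classical_set_scope.
Local Open Scope complex_scope.
Local Open Scope ring_scope.
Local Open Scope op_scope.

(** * Real-valued norms *)

Section RealNorm.
Context {R : realType} {V : normedModType R[i]}.
Implicit Types x y : V.

(** Norms lie in [R[i]] but are real; passing to [R] gives estimates in a totally ordered field. *)
Definition rnorm x : R := complex.Re `|x|.

Lemma rnormE x : `|x| = (rnorm x)%:C.
Proof.
by have := normr_ge0 x; rewrite lecE /rnorm; case: `|x| => a b /= /andP[/eqP->].
Qed.

Lemma rnorm_ge0 x : 0 <= rnorm x.
Proof. by have := normr_ge0 x; rewrite rnormE -lecR. Qed.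

Lemma rnorm0 : rnorm 0 = 0.
Proof. by rewrite /rnorm normr0. Qed.

Lemma rnorm_eq0 x : rnorm x = 0 -> x = 0.
Proof. by move=> x0; apply/eqP; rewrite -normr_eq0 rnormE x0. Qed.

Lemma rnormN x : rnorm (- x) = rnorm x.
Proof. by rewrite /rnorm normrN. Qed.

Lemma rnormD x y : rnorm (x + y) <= rnorm x + rnorm y.
Proof. by have := ler_normD x y; rewrite !rnormE -rmorphD lecR. Qed.

Lemma rnormB x y : rnorm (x - y) <= rnorm x + rnorm y.
Proof. by rewrite -(rnormN y) rnormD. Qed.

Lemma rnormZ (c : R) x : rnorm (c%:C *: x) = `|c| * rnorm x.
Proof.
apply: (@complexI R); rewrite rmorphM /= -!rnormE normrZ; congr (_ * _).
by rewrite normc_def /= expr0n addr0 sqrtr_sqr.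
Qed.

Lemma rnormZi x : rnorm ('i%C *: x) = rnorm x.
Proof.
apply: (@complexI R); rewrite -!rnormE normrZ.
by rewrite normc_def /= expr0n add0r expr1n sqrtr1 mul1r.
Qed.

End RealNorm.

(** * Geometric series in complete modules *)

Lemma expr_lt_eps (R : realType) (C r e : R) : 0 <= r -> r < 1 -> 0 < e ->
  exists n, C * r ^+ n < e.
Proof.
move=> r0 r1 e0.
have : geometric C r @ \oo --> 0 by apply: cvg_geometric; rewrite ger0_norm.
move=> /cvgrPdist_lt /(_ _ e0) [n _ /(_ n (leqnn n))] /=.
rewrite sub0r normrN => h; exists n; exact: le_lt_trans (ler_norm _) h.
Qed.

Section Geometric.
Context {R : realType} {V : completeNormedModType R[i]}.

(** Completeness enters here; the explicit tail bound replaces later passages to the limit. *)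
Lemma geometric_cvg (u : nat -> V) (C r : R) : 0 <= r -> r < 1 ->
  (forall n, rnorm (u n) <= C * r ^+ n) ->
  exists l, forall n, rnorm (l - \sum_(k < n) u k) <= C / (1 - r) * r ^+ n.
Proof.
move=> r0 r1 uC; pose S n := \sum_(k < n) u k.
have C0 : 0 <= C by have := uC 0%N; rewrite mulr1; exact/le_trans/rnorm_ge0.
have r1' : 0 < 1 - r by rewrite subr_gt0.
have SB n m : rnorm (S (n + m)%N - S n) <= C / (1 - r) * r ^+ n.
  (* The sharper bound is the exact finite geometric sum, which induction on [m] preserves. *)
  suff h : rnorm (S (n + m)%N - S n) <= C / (1 - r) * (r ^+ n - r ^+ (n + m)).
    apply: (le_trans h); apply: ler_wpM2l; first by rewrite divr_ge0 // ltW.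
    by rewrite gerBl exprn_ge0.
  elim: m => [|m IH]; first by rewrite addn0 !subrr rnorm0 mulr0.
  rewrite addnS {1}/S big_ord_recr /= -/(S _) addrAC.
  apply: (le_trans (rnormD _ _)); apply: (le_trans (lerD IH (uC _))).
  rewrite le_eqVlt; apply/orP; left; apply/eqP.
  rewrite exprS; field; exact: lt0r_neq0.
have SB' n m : (n <= m)%N -> rnorm (S m - S n) <= C / (1 - r) * r ^+ n.
  by move=> /subnKC <-.
have : cvg (S @ \oo).
  apply/cauchy_cvgP/cauchy_exP => -[e e']; rewrite ltcE /= => /andP[/eqP-> e0].
  have [n hn] := expr_lt_eps (C / (1 - r)) r0 r1 e0.
  exists (S n), n => // m /= nm; rewrite -ball_normE /=.
  rewrite -opprB normrN rnormE ltcR.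
  exact: le_lt_trans (SB' _ _ nm) hn.
move=> /cvg_ex[l Sl]; exists l => n; apply/ler_addgt0Pr => e e0.
have e0' : 0 < e%:C by rewrite ltcR.
move/cvgrPdist_lt : Sl => /(_ _ e0')[m _ hm].
have {}hm := hm (n + m)%N (leq_addl _ _).
rewrite /= rnormE ltcR in hm.
rewrite -(subrKA (S (n + m)%N)); apply: (le_trans (rnormD _ _)).
by rewrite addrC; apply: lerD => //; exact: ltW.
Qed.

End Geometric.

(** * Bounds for inner products and for adjointable maps *)

Section InnerBound.
Context {R : realType} {A : cstarAlgType R}.
Implicit Types H K : hilbertModType A.

Lemma innerZl H (c : R[i]) (x y : H) : inner (c *: x) y = c^*%C *: inner x y.
Proof. by rewrite -inner_star innerZr cstarZ inner_star. Qed.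

Lemma real_complex2 : (2 : R)%:C = 2%:R :> R[i].
Proof. exact: (rmorph_nat (real_complex R) 2). Qed.

Lemma rnorm_inner H (x : H) : rnorm (inner x x) = rnorm x ^+ 2.
Proof.
by apply: (@complexI R); rewrite rmorphXn /= -!rnormE hnormE.
Qed.

(** The sum is <x+y, x+y> - <x, x> - <y, y>, and |x+y|^2 is at most 2(|x|^2 + |y|^2). *)
Lemma rnorm_inner_sym H (x y : H) :
  rnorm (inner x y + inner y x) <= 3 * (rnorm x ^+ 2 + rnorm y ^+ 2).
Proof.
have -> : inner x y + inner y x
    = inner (x + y) (x + y) - inner x x - inner y y.
  apply/eqP; rewrite -addrA -opprD eq_sym subr_eq innerDr !inner_addl.
  by rewrite (addrC (inner x x)) addrACA (addrC (inner y x)).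
apply: (le_trans (rnormB _ _)); rewrite !rnorm_inner.
apply: (le_trans (lerD (rnormB _ _) (lexx _))); rewrite !rnorm_inner.
have := rnormD x y; have := rnorm_ge0 (x + y).
move: (rnorm _) (rnorm x) (rnorm y) => a b c a0 abc.
have : a ^+ 2 <= (b + c) ^+ 2 by rewrite lerXn2r ?nnegrE ?(le_trans a0).
by have := sqr_ge0 (b - c); nra.
Qed.

(* A crude Cauchy-Schwarz inequality: the constant comes from polarization,
   which spares the order on A that the sharp one would need. *)
Lemma rnorm_inner_le H (x y : H) :
  rnorm (inner x y) <= 6 * (rnorm x * rnorm y).
Proof.
have crude (u v : H) : rnorm (inner u v) <= 3 * (rnorm u ^+ 2 + rnorm v ^+ 2).
  have h1 := rnorm_inner_sym u v; have := rnorm_inner_sym u ('i%C *: v).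
  rewrite rnormZi innerZr innerZl => h2.
  (* Replacing v by iv changes the relative sign of the two products, so <v, u> cancels. *)
  have e : (2 : R)%:C *: inner u v = (inner u v + inner v u)
      - 'i%C *: ('i%C *: inner u v + ('i%C)^*%C *: inner v u).
    rewrite scalerDr !scalerA opprD -!scaleNr -expr2 sqr_i mulrC.
    have -> : - (('i%C)^*%C * 'i%C) = -1 :> R[i] by simpc.
    rewrite opprK scale1r scaleN1r addrACA subrr addr0 -mulr2n.
    by rewrite -[RHS]scaler_nat real_complex2.
  have : rnorm ((2 : R)%:C *: inner u v) <= 6 * (rnorm u ^+ 2 + rnorm v ^+ 2).
    rewrite e; apply: (le_trans (rnormB _ _)); rewrite rnormZi.
    by apply: (le_trans (lerD h1 h2)); lra.
  by rewrite rnormZ ger0_norm // => h; lra.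
have [x0|x0] := eqVneq (rnorm x) 0.
  by rewrite (rnorm_eq0 x0) inner_lin0l !rnorm0 mul0r mulr0.
have [y0|y0] := eqVneq (rnorm y) 0.
  by rewrite (rnorm_eq0 y0) inner_lin0r !rnorm0 !mulr0.
(* Rescaling to equal norms turns the sum of squares into twice a product. *)
have := crude ((rnorm y)%:C *: x) ((rnorm x)%:C *: y).
rewrite innerZr innerZl !rnormZ.
have -> : rnorm ((rnorm y)%:C^*%C *: inner x y) = rnorm y * rnorm (inner x y).
  by rewrite conjc_real rnormZ ger0_norm // rnorm_ge0.
rewrite !ger0_norm ?rnorm_ge0 //.
have p : 0 < rnorm x * rnorm y.
  by rewrite mulr_gt0 // lt_neqAle eq_sym ?x0 ?y0 rnorm_ge0.
move=> h; rewrite -(ler_pM2l p).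
have <- : rnorm x * (rnorm y * rnorm (inner x y))
    = rnorm x * rnorm y * rnorm (inner x y) by ring.
apply: (le_trans h); rewrite le_eqVlt; apply/orP; left; apply/eqP; ring.
Qed.

(** Linearity comes from the adjoint: <z, Tx> = <T^* z, x> is additive in x for each z. *)
Lemma opfunD H K (T : 'L(H, K)) (x y : H) : T (x + y) = T x + T y.
Proof.
by apply: inner_inj => z; rewrite innerDr -!(opadjP (adjop T)) /= innerDr.
Qed.

Lemma opfunZ H K (T : 'L(H, K)) (c : R[i]) (x : H) : T (c *: x) = c *: T x.
Proof.
by apply: inner_inj => z; rewrite innerZr -!(opadjP (adjop T)) /= innerZr.
Qed.

Lemma opfun0 H K (T : 'L(H, K)) : T 0 = 0.
Proof. by rewrite -(scale0r 0) opfunZ scale0r. Qed.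

Lemma opfunN H K (T : 'L(H, K)) (x : H) : T (- x) = - T x.
Proof. by rewrite -scaleN1r opfunZ scaleN1r. Qed.

Lemma opfunB H K (T : 'L(H, K)) (x y : H) : T (x - y) = T x - T y.
Proof. by rewrite opfunD opfunN. Qed.

Lemma unbounded_vector H K (T : 'L(H, K)) :
  ~ (exists2 b : R, 0 <= b & forall x, rnorm (T x) <= b * rnorm x) ->
  forall c : R, 0 <= c -> exists x : H, rnorm x <= 1 /\ c < rnorm (T x).
Proof.
move=> nb c c0; apply: contrapT => nx; apply: nb; exists c => // x.
have [x0|x0] := eqVneq (rnorm x) 0.
  by rewrite (rnorm_eq0 x0) opfun0 !rnorm0 mulr0.
have p : 0 < rnorm x by rewrite lt_neqAle eq_sym x0 rnorm_ge0.
rewrite leNgt; apply/negP => lt_c; apply: nx.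
exists (((rnorm x)^-1)%:C *: x); rewrite opfunZ !rnormZ gtr0_norm ?invr_gt0 //.
by rewrite mulVf // lexx mulrC ltr_pdivlMr.
Qed.

(* Gliding hump: otherwise pick x_n in the unit ball with
   |T x_n| > 2 (n + 1) 13^n, and let l be the sum of the vectors
   +- 13^-n T x_n / |T x_n|, with signs such that |<T x_n, l>| >= n + 1; but
   <T x_n, l> = <x_n, T^* l> is at most 6 |T^* l|.  The ratio 1/13 makes
   the tails small compared to the constant 6 of rnorm_inner_le. *)
Lemma adjointable_bounded H K (T : 'L(H, K)) :
  exists2 b : R, 0 <= b & forall x, rnorm (T x) <= b * rnorm x.
Proof.
apply: contrapT => /unbounded_vector unb.
pose c n : R := (n%:R + 1) * 2 * 13 ^+ n.
have c0 n : 0 <= c n by rewrite !mulr_ge0 ?addr_ge0 ?exprn_ge0 ?ler0n.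
have /choice[x xP] : forall n, exists x : H, rnorm x <= 1 /\ c n < rnorm (T x).
  by move=> n; apply: unb.
pose t n := rnorm (T (x n)).
have ct n : c n < t n := (xP n).2.
have t0 n : 0 < t n := le_lt_trans (c0 n) (ct n).
pose r : R := 13^-1.
have r0 : 0 <= r by rewrite invr_ge0.
have r1 : r < 1 by rewrite invf_lt1 // ltr1n.
have rt n : 0 <= r ^+ n / t n by rewrite divr_ge0 ?exprn_ge0 // ltW.
pose v n := (r ^+ n / t n)%:C *: T (x n).
have vE n : rnorm (v n) = r ^+ n.
  by rewrite rnormZ ger0_norm // -/(t n) divfK // lt0r_neq0.
pose phi n y := rnorm (inner (T (x n)) y).
have phiv n : phi n (v n) = r ^+ n * t n.
  rewrite /phi innerZr rnormZ rnorm_inner ger0_norm //.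
  by rewrite -/(t n) expr2 mulrA divfK // lt0r_neq0.
(* One sign always works: the products of [T (x n)] with [y + v n] and [y - v n] differ by twice
   that with [v n], whose norm is [r ^+ n * t n]. *)
pose sgv n y := if r ^+ n * t n <= phi n (y + v n) then v n else - v n.
have sgvE n y : rnorm (sgv n y) = r ^+ n.
  by rewrite /sgv; case: ifP; rewrite ?rnormN vE.
have sgvP n y : r ^+ n * t n <= phi n (y + sgv n y).
  rewrite /sgv; case: ifPn => //; rewrite -ltNge => lt1.
  have : 2 * (r ^+ n * t n) <= phi n (y + v n) + phi n (y - v n).
    rewrite -phiv /phi.
    have := rnormB (inner (T (x n)) (y + v n)) (inner (T (x n)) (y - v n)).
    rewrite !innerDr inner_oppr opprD opprK addrACA subrr add0r -mulr2n.
    rewrite -(scaler_nat 2 (inner _ _)).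
    by rewrite -real_complex2 rnormZ ger0_norm.
  by lra.
pose s := fix s n := if n is m.+1 then s m + sgv m (s m) else 0 : K.
have sE n : s n = \sum_(k < n) sgv k (s k).
  by elim: n => [|n IH]; rewrite ?big_ord0 // big_ord_recr /= -IH.
have [|l hl] := @geometric_cvg _ _ (fun n => sgv n (s n)) 1 r r0 r1.
  by move=> n; rewrite sgvE mul1r.
have big n : n%:R + 1 <= phi n l.
  (* The tail is at most r^(n+1)/(1 - r) = r^n/12, so with the factor 6 it costs half of
     [r ^+ n * t n]; the other half is at least n + 1 by the choice of [c]. *)
  have h : phi n (s n.+1 - l) <= 6 * (t n * (r ^+ n / 12)).
    apply: (le_trans (rnorm_inner_le _ _)).
    rewrite ler_pM2l // ler_pM2l; last exact: t0.
    rewrite -rnormN opprB sE; apply: (le_trans (hl _)).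
    have -> : 1 / (1 - r) * r ^+ n.+1 = r ^+ n / 12 by rewrite exprS /r; field.
    by [].
  have : phi n (s n.+1) <= phi n (s n.+1 - l) + phi n l.
    have := rnormD (inner (T (x n)) (s n.+1 - l)) (inner (T (x n)) l).
    by rewrite -innerDr subrK.
  have := sgvP n (s n); rewrite -/(s n.+1) => h1 h2.
  have : (n%:R + 1) * 2 <= r ^+ n * t n.
    rewrite /r exprVn [leRHS]mulrC ler_pdivlMr ?exprn_gt0 //; exact/ltW/ct.
  lra.
have up n : phi n l <= 6 * rnorm (opadj T l).
  rewrite /phi opadjP; apply: (le_trans (rnorm_inner_le _ _)).
  rewrite ler_pM2l // ler_piMl ?rnorm_ge0 //; exact: (xP n).1.
have := big (Num.bound (6 * rnorm (opadj T l))).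
have := archi_boundP (mulr_ge0 (ler0n _ 6) (rnorm_ge0 (opadj T l))).
move=> h1 h2; have := le_trans h2 (up _); lra.
Qed.

End InnerBound.

(** * Solving x + Bx = y for skew-adjoint B *)

Section SkewResolvent.
Context {R : realType} {A : cstarAlgType R} {H : hilbertModType A}.
Context (B : 'L(H)) (B_skew : B^** = - B).

Let skewE (x y : H) : inner (B x) y = - inner x (B y).
Proof.
rewrite opadjP -inner_oppr; congr inner.
exact: (congr1 (fun T : 'L(H) => T y) B_skew).
Qed.

Let skew_shift (s : R) (x : H) : H := s%:C *: x - B x.
Let skew_quad (s : R) (x : H) : H := (s ^+ 2)%:C *: x - B (B x).

Let skew_shift_inner s x y :
  inner (skew_shift s x) (skew_shift s y) = inner x (skew_quad s y).
Proof.
rewrite /skew_shift /skew_quad !(innerDr, inner_addl, inner_oppl, inner_oppr).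
rewrite !(innerZr, innerZl) !skewE conjc_real scalerA -rmorphM /= -expr2.
by rewrite scalerN !opprK opprD addrA addrK.
Qed.

Let skew_comm s x :
  skew_quad s (skew_shift s x) = skew_shift s (skew_quad s x).
Proof.
rewrite /skew_shift /skew_quad !(opfunB, opfunZ) !scalerBr !scalerA.
rewrite [(s ^+ 2)%:C * _]mulrC !opprB !addrA.
by rewrite addrAC [X in X + _]addrAC [RHS]addrAC.
Qed.

(** Comparing n-th iterates directly lets the crude Cauchy-Schwarz inequality be applied once, so
    its constant is not raised to the power n. *)
Let skew_iter_inner s n x y :
  inner (iter n (skew_shift s) x) (iter n (skew_shift s) y)
  = inner x (iter n (skew_quad s) y).
Proof.
elim: n x y => [//|n IH] x y.
rewrite [in RHS]iterS -skew_shift_inner.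
have -> : skew_shift s (iter n (skew_quad s) y)
    = iter n (skew_quad s) (skew_shift s y).
  by elim: n {IH} => [//|n IHn] /=; rewrite -skew_comm IHn.
by rewrite -IH -!iterSr.
Qed.

(* 1 + B = (1 + s) - (s - B), and since (s - B)^*(s - B) = s^2 - B^2 the
   spectral radius of s - B is at most sqrt (s^2 + b^2) < 1 + s when B is
   bounded by b and s = b^2. *)
Lemma skew_surj (y : H) : exists x, x + B x = y.
Proof.
have [b b0 Bb] := adjointable_bounded B.
pose s := b ^+ 2; pose d := s ^+ 2 + s; pose q := 1 + s.
have s0 : 0 <= s := sqr_ge0 b.
have d0 : 0 <= d by rewrite addr_ge0 ?sqr_ge0.
have q0 : 0 < q by rewrite ltr_pwDl.
pose U := skew_shift s; pose D := skew_quad s.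
have Dd x : rnorm (D x) <= d * rnorm x.
  apply: (le_trans (rnormB _ _)).
  rewrite rnormZ ger0_norm ?sqr_ge0 // mulrDl lerD2l.
  apply: (le_trans (Bb _)); rewrite /s expr2 -mulrA; exact: ler_wpM2l.
have Dn n x : rnorm (iter n D x) <= d ^+ n * rnorm x.
  elim: n => [|n IH]; first by rewrite mul1r.
  by apply: (le_trans (Dd _)); rewrite exprS -mulrA ler_wpM2l.
pose w := Num.sqrt d.
(* Here 3 bounds the square root of the constant 6 in [rnorm_inner_le]. *)
have Un n x : rnorm (iter n U x) <= 3 * rnorm x * w ^+ n.
  have x0 := rnorm_ge0 x.
  rewrite -(@ler_pXn2r _ 2) ?nnegrE //; last 2 first.
  - exact: rnorm_ge0.
  - by rewrite !mulr_ge0 ?exprn_ge0 ?sqrtr_ge0.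
  rewrite -rnorm_inner skew_iter_inner; apply: (le_trans (rnorm_inner_le _ _)).
  rewrite !exprMn -exprM mulnC exprM sqr_sqrtr //.
  have := ler_wpM2l x0 (Dn n x).
  have : 0 <= rnorm x * (d ^+ n * rnorm x) by rewrite !mulr_ge0 ?exprn_ge0.
  by move=> *; nra.
pose r := w / q.
have r0 : 0 <= r by rewrite divr_ge0 ?sqrtr_ge0 // ltW.
(* [q ^+ 2] exceeds [d] by [1 + s]. *)
have r1 : r < 1.
  rewrite ltr_pdivrMr // mul1r.
  rewrite -(@ltr_pXn2r _ 2) ?nnegrE ?sqrtr_ge0 ?(ltW q0) //.
  by rewrite sqr_sqrtr // /d /q; nra.
(* Terms of the Neumann series for (q - U)^-1 y, where q - U = 1 + B. *)
pose u n := ((q ^+ n.+1)^-1)%:C *: iter n U y.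
have uE n : rnorm (u n) <= 3 * rnorm y / q * r ^+ n.
  have qn : 0 <= (q ^+ n.+1)^-1 by rewrite invr_ge0 exprn_ge0 // ltW.
  rewrite rnormZ ger0_norm //; apply: (le_trans (ler_wpM2l qn (Un n y))).
  rewrite le_eqVlt; apply/orP; left; apply/eqP.
  by rewrite exprMn exprVn exprS invfM; ring.
have [l hl] := geometric_cvg r0 r1 uE.
pose S n := \sum_(k < n) u k.
have SE n : S n + B (S n) = y - ((q ^+ n)^-1)%:C *: iter n U y.
  elim: n => [|n IH].
    by rewrite /S big_ord0 opfun0 addr0 /= expr0 invr1 scale1r subrr.
  rewrite /S big_ord_recr /= -/(S n) opfunD addrACA IH -addrA; congr (_ + _).
  rewrite /u opfunZ.
  have -> : ((q ^+ n)^-1)%:C = ((q ^+ n.+1)^-1)%:C * q%:C.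
    by rewrite -rmorphM /= exprSr invfM divfK // lt0r_neq0.
  rewrite -scalerA -!scalerN -!scalerDr; congr (_ *: _).
  set z := iter n U y; rewrite /U /skew_shift /q rmorphD /= scalerDl scale1r.
  by rewrite scalerN opprB [- z + _]addrC addrA subrK addrC.
pose C := 3 * rnorm y / q / (1 - r).
(* The residual of [l] does not depend on [n], while its bound tends to 0. *)
have err n : rnorm (l + B l - y) <= ((1 + b) * C + 3 * rnorm y) * r ^+ n.
  have -> : l + B l - y
      = (l - S n) + B (l - S n) - ((q ^+ n)^-1)%:C *: iter n U y.
    have -> : ((q ^+ n)^-1)%:C *: iter n U y = y - (S n + B (S n)).
      by rewrite SE opprB addrC subrK.
    by rewrite opfunB addrACA -opprD opprB addrA subrK.
  have qn : 0 <= (q ^+ n)^-1 by rewrite invr_ge0 exprn_ge0 // ltW.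
  apply: (le_trans (rnormB _ _)); rewrite mulrDl; apply: lerD.
    apply: (le_trans (rnormD _ _)); rewrite mulrDl mul1r mulrDl.
    apply: lerD; first exact: hl.
    by apply: (le_trans (Bb _)); rewrite -mulrA ler_wpM2l // hl.
  rewrite rnormZ ger0_norm //; apply: (le_trans (ler_wpM2l qn (Un n y))).
  rewrite le_eqVlt; apply/orP; left; apply/eqP.
  by rewrite exprMn exprVn; ring.
exists l; apply/eqP; rewrite -subr_eq0; apply/eqP/rnorm_eq0/eqP.
rewrite eq_le rnorm_ge0 andbT leNgt; apply/negP => lt0.
have [n hn] := expr_lt_eps ((1 + b) * C + 3 * rnorm y) r0 r1 lt0.
by have := lt_le_trans hn (err n); rewrite ltxx.
Qed.

End SkewResolvent.

(** * Operator algebra and inverses *)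

Section OperatorAlgebra.
Context {R : realType} {A : cstarAlgType R}.
Implicit Types H K L G : hilbertModType A.

Lemma compopA H K L G (S : 'L(L, G)) (T : 'L(K, L)) (U : 'L(H, K)) :
  S ** (T ** U) = S ** T ** U.
Proof. exact: adjointable_ext. Qed.

Lemma comp1op H K (T : 'L(H, K)) : idop K ** T = T.
Proof. exact: adjointable_ext. Qed.

Lemma compop1 H K (T : 'L(H, K)) : T ** idop H = T.
Proof. exact: adjointable_ext. Qed.

Lemma compopDl H K L (S T : 'L(K, L)) (U : 'L(H, K)) :
  (S + T) ** U = S ** U + T ** U.
Proof. exact: adjointable_ext. Qed.

Lemma compopNl H K L (S : 'L(K, L)) (U : 'L(H, K)) : (- S) ** U = - (S ** U).
Proof. exact: adjointable_ext. Qed.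

Lemma compopBl H K L (S T : 'L(K, L)) (U : 'L(H, K)) :
  (S - T) ** U = S ** U - T ** U.
Proof. exact: adjointable_ext. Qed.

Lemma compopDr H K L (S : 'L(K, L)) (T U : 'L(H, K)) :
  S ** (T + U) = S ** T + S ** U.
Proof. by apply: adjointable_ext => x; exact: opfunD. Qed.

Lemma compopNr H K L (S : 'L(K, L)) (T : 'L(H, K)) : S ** (- T) = - (S ** T).
Proof. by apply: adjointable_ext => x; exact: opfunN. Qed.

Lemma compopBr H K L (S : 'L(K, L)) (T U : 'L(H, K)) :
  S ** (T - U) = S ** T - S ** U.
Proof. by rewrite compopDr compopNr. Qed.

Lemma adjopM H K L (S : 'L(K, L)) (T : 'L(H, K)) : (S ** T)^** = T^** ** S^**.
Proof. exact: adjointable_ext. Qed.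

Lemma adjopD H K (S T : 'L(H, K)) : (S + T)^** = S^** + T^**.
Proof. exact: adjointable_ext. Qed.

Lemma adjopB H K (S T : 'L(H, K)) : (S - T)^** = S^** - T^**.
Proof. exact: adjointable_ext. Qed.

Lemma adjopK H K (T : 'L(H, K)) : T^**^** = T.
Proof. exact: adjointable_ext. Qed.

Lemma adjop1 H : (idop H)^** = idop H.
Proof. exact: adjointable_ext. Qed.

Lemma opinvP H (T : 'L(H)) : op_invertible T -> is_opinv T (opinv T).
Proof. by case=> S TS; rewrite /opinv; case: xgetP => // /(_ S). Qed.

Lemma left_right_opinv H (T S S' : 'L(H)) :
  S ** T = idop H -> T ** S' = idop H -> S = S'.
Proof. by move=> ST TS'; rewrite -(compop1 S) -TS' compopA ST comp1op. Qed.

Lemma weight_opinv H (T : 'L(H)) : weight T -> weight (opinv T).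
Proof.
move=> [TT TV]; have [TS ST] := opinvP TV; split; last by exists T.
apply: (@left_right_opinv _ T) => //.
by rewrite -{2}TT -adjopM TS adjop1.
Qed.

(** With y = T^-1 x, one has <x, T^-1 x> = <y, Ty>. *)
Lemma positive_definite_opinv H (T : 'L(H)) :
  positive_definite T -> positive_definite (opinv T).
Proof.
move=> [Tw Tp]; have [ST SV] := weight_opinv Tw; split => // x.
have [TS _] := opinvP Tw.2; have := Tp (opinv T x).
rewrite -[T (opinv T x)]/((T ** opinv T) x) TS.
by rewrite opadjP -[opadj _ x]/((opinv T)^** x) ST.
Qed.

(** Surjectivity of 1 + B and of its adjoint 1 - B gives right inverses S and S' by choice. Since
    <Sx, y> = <Sx, (1 - B)S'y> = <x, S'y>, they are mutually adjoint, which makes S a left inverse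
    too. *)
Lemma skew_invertible H (B : 'L(H)) : B^** = - B -> op_invertible (idop H + B).
Proof.
move=> B_skew.
have /choice[S SP] : forall y, exists x, x + B x = y by exact: skew_surj.
have B_skew' : (- B)^** = - - B.
  by rewrite -B_skew adjopK B_skew opprK.
have /choice[S' S'P] : forall y, exists x, x - B x = y.
  exact: (skew_surj B_skew').
have SS' x y : inner (S x) y = inner x (S' y).
  rewrite -{1}(S'P y) -{2}(SP x) innerDr inner_addl inner_oppr opadjP.
  by rewrite -[opadj B _]/(B^** (S' y)) B_skew inner_oppr.
exists (Adjointable SS'); have e : (idop H + B) ** Adjointable SS' = idop H.
  by apply: adjointable_ext => x; exact: SP.
split=> //; apply: adjointable_ext => x; apply: inner_inj => y.
change (inner y (S (x + B x)) = inner y x).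
rewrite -[LHS]inner_star SS' -{2}(S'P y) -[RHS]inner_star innerDr inner_addl.
by rewrite inner_oppr opadjP -[opadj B _]/(B^** (S' y)) B_skew inner_oppr.
Qed.

End OperatorAlgebra.

(** * Idempotents, projections and weighted inverses *)

Section WeightedInverse.
Context {R : realType} {A : cstarAlgType R}.
Implicit Types H K : hilbertModType A.

(* For B = F - F^* one has (1 - B)(1 + B) = (F + F^* - 1)^2, which commutes
   with F and F^*; so F^* F ((1 - B)(1 + B))^-1 is the projection onto the
   orthogonal complement of the kernel of F. *)
Lemma idempotent_projection H (F : 'L(H)) : F ** F = F ->
  exists P : 'L(H), [/\ P^** = P, F ** P = F & P ** F = P].
Proof.
move=> FF; pose B := F - F^**.
have FF' : F^** ** F^** = F^** by rewrite -adjopM FF.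
have B_skew : B^** = - B by rewrite adjopB adjopK opprB.
have [S [BS SB]] := skew_invertible B_skew.
have [S' [BS' SB']] : op_invertible (idop H - B).
  by apply: skew_invertible; rewrite -B_skew adjopK B_skew opprK.
pose D := (idop H - B) ** (idop H + B); pose E := S ** S'.
have DE : D ** E = idop H.
  by rewrite /D /E -compopA (compopA _ S) BS comp1op.
have ED : E ** D = idop H.
  by rewrite /D /E -compopA (compopA S') SB' comp1op.
clearbody E; have Dstar : D^** = D.
  by rewrite /D adjopM adjopB adjopD adjop1 B_skew opprK.
have DsE : D = idop H - F - F^** + F ** F^** + F^** ** F.
  rewrite /D compopBl comp1op compopDr compop1 addrKA /B.
  rewrite compopBl !compopBr FF FF' 2!opprB -!addrA; congr (_ + _).
  by rewrite addrC -!addrA [RHS]addrCA; congr (_ + _); rewrite addrCA.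
(* [FD] and [DF] have the same right-hand side, so D and its inverse [E] commute with F. *)
have FD : F ** D = F ** F^** ** F.
  rewrite DsE !compopDr !compopNr compop1 FF !compopA FF.
  by rewrite subrr add0r addNr add0r.
have DF : D ** F = F ** F^** ** F.
  rewrite DsE !compopDl !compopNl comp1op -(compopA F^** F F) FF.
  by rewrite subrr add0r addrAC addNr add0r.
have Estar : E^** = E.
  by apply: (@left_right_opinv _ _ _ D) => //; rewrite -Dstar -adjopM DE adjop1.
have EF : E ** F = F ** E.
  by rewrite -[LHS]compop1 -DE compopA -(compopA E) FD -DF compopA ED comp1op.
have EF' : E ** F^** = F^** ** E by rewrite -{1}Estar -adjopM -EF adjopM Estar.
exists (F^** ** F ** E); split.
- by rewrite !adjopM adjopK Estar compopA EF' -!compopA EF.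
- by rewrite !compopA -FD -compopA DE compop1.
- by rewrite -compopA EF compopA -(compopA F^**) FF.
Qed.

(** NF = NFG = F^*NG = (GF)^*N = G^*N = NG, and N cancels. *)
Lemma weighted_idempotent_uniq H (N F G : 'L(H)) : weight N ->
  (N ** F)^** = N ** F -> (N ** G)^** = N ** G ->
  F ** G = F -> G ** F = G -> F = G.
Proof.
move=> [NN [N' [_ N'N]]] NF NG FG GF.
suff NFG : N ** F = N ** G.
  by rewrite -(comp1op F) -N'N -compopA NFG compopA N'N comp1op.
rewrite -{1}FG compopA -NF adjopM NN -compopA -NG adjopM NN.
by rewrite compopA -adjopM GF.
Qed.

(** The hypothesis reads Q = M^-1 Q^* M. This carries statements about [X ** T] and N over to
    [(T ** X)^**] and M^-1. *)
Lemma weight_opinv_adj H (M Q : 'L(H)) : weight M -> (M ** Q)^** = M ** Q ->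
  (opinv M ** Q^**)^** = opinv M ** Q^**.
Proof.
move=> Mw MQ; have [M'M' _] := weight_opinv Mw; have [MM' M'M] := opinvP Mw.2.
rewrite adjopM adjopK M'M'.
suff QM : Q = opinv M ** Q^** ** M by rewrite {1}QM -compopA MM' compop1.
by rewrite -compopA -[X in Q^** ** X]Mw.1 -adjopM MQ compopA M'M comp1op.
Qed.

(** XT and YT both have the kernel of T, and (TX)^* and (TY)^* that of T^*, so each pair coincides;
    then X = XTX = YTX = YTY = Y. *)
Lemma wmpinv_uniq H K (M : 'L(K)) (N : 'L(H)) (T : 'L(H, K)) X Y :
  weight M -> weight N -> is_wmpinv M N T X -> is_wmpinv M N T Y -> X = Y.
Proof.
move=> Mw Nw [TX X1 X2 X3] [TY Y1 Y2 Y3].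
rewrite -!compopA in X2 X3 Y2 Y3.
have XY : X ** T = Y ** T.
  apply: (weighted_idempotent_uniq Nw) => //.
  - by rewrite -compopA (compopA T) TY.
  - by rewrite -compopA (compopA T) TX.
have YX : T ** X = T ** Y.
  rewrite -(adjopK (T ** X)) -(adjopK (T ** Y)); congr _^**.
  apply: (weighted_idempotent_uniq (weight_opinv Mw)).
  - exact: weight_opinv_adj.
  - exact: weight_opinv_adj.
  - by rewrite -adjopM compopA TY.
  - by rewrite -adjopM compopA TX.
by rewrite -X1 XY -compopA YX compopA Y1.
Qed.

Lemma is_wmpinv_wmpinv H K (M : 'L(K)) (N : 'L(H)) (T : 'L(H, K)) :
  has_wmpinv M N T -> is_wmpinv M N T (wmpinv M N T).
Proof. by case=> X TX; rewrite /wmpinv; case: xgetP => // /(_ X). Qed.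

Lemma wmpinvE H K (M : 'L(K)) (N : 'L(H)) (T : 'L(H, K)) X :
  weight M -> weight N -> is_wmpinv M N T X -> wmpinv M N T = X.
Proof.
move=> Mw Nw TX; apply: (wmpinv_uniq Mw Nw _ TX).
by apply: is_wmpinv_wmpinv; exists X.
Qed.

(** With P the projection onto the orthogonal complement of ker T and E the one onto the range of T,
    the inverse is Y = PXE: TY = E and YT = P. *)
Lemma regular_has_mpinv H K (T : 'L(H, K)) (X : 'L(K, H)) :
  T ** X ** T = T -> has_mpinv T.
Proof.
move=> TXT.
have [|P [PP FP PF]] := @idempotent_projection _ (X ** T).
  by rewrite -compopA (compopA T) TXT.
have [|E [EE QE EQ]] := @idempotent_projection _ (T ** X)^**.
  by rewrite -adjopM compopA TXT.
have {}QE : E ** T ** X = T ** X.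
  by rewrite -compopA -{1}EE -[T ** X in LHS]adjopK -adjopM QE adjopK.
have {}EQ : T ** X ** E = E.
  by rewrite -{1}EE -[T ** X in LHS]adjopK -adjopM EQ.
have TP : T ** P = T by rewrite -{1}TXT -!compopA (compopA X) FP compopA.
have ET : E ** T = T by rewrite -{1}TXT !compopA QE TXT.
have TY : T ** (P ** X ** E) = E by rewrite !compopA TP.
have YT : P ** X ** E ** T = P by rewrite -compopA ET -compopA.
have P2 : P ** P = P by rewrite -{1}PF -compopA FP PF.
exists (P ** X ** E); split.
- by rewrite TY ET.
- by rewrite YT !compopA P2.
- by rewrite comp1op TY.
- by rewrite comp1op YT.
Qed.

(* P + N (1 - P) N = R^* R for R = P + (1 - P) N, and R has the explicit
   inverse F + (1 - F) N^-1. *)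
Lemma compressed_weight H (N P F : 'L(H)) : weight N ->
  P^** = P -> P ** P = P -> P ** F = P -> F ** P = F -> (N ** F)^** = N ** F ->
  positive_definite (P + N ** (idop H - P) ** N) /\
  (P + N ** (idop H - P) ** N) ** F = P.
Proof.
move=> [NN [N' [NN' N'N]]] PP P2 PF FP NF.
pose I := idop H; pose Q := I - P; pose T := P + N ** Q ** N.
have QQ : Q^** = Q by rewrite adjopB adjop1 PP.
have QP : Q ** P = 0 by rewrite compopBl comp1op P2 subrr.
have PQ : P ** Q = 0 by rewrite compopBr compop1 P2 subrr.
have Q2 : Q ** Q = Q by rewrite {1}/Q compopBl comp1op PQ subr0.
have {}NF : N ** F = F^** ** N by rewrite -NF adjopM NN.
have QF' : Q ** F^** = 0.
  rewrite -QQ -adjopM compopBr compop1 FP subrr; exact: adjointable_ext.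
have FQ : F ** Q = 0 by rewrite compopBr compop1 FP subrr.
pose U := P + Q ** N; pose V := F + (I - F) ** N'.
have c0 (X : 'L(H)) : 0 ** X = 0 by exact: adjointable_ext.
have comp0 (X : 'L(H)) : X ** 0 = 0.
  by apply: adjointable_ext => x; exact: opfun0.
(* NF = F^*N conjugated by N^-1; moving N^-1 to the left lets QF^* = 0 and F^*P = P remove the cross
   terms. *)
have VN' : (I - F) ** N' = N' ** (I - F^**).
  rewrite compopBl compopBr comp1op compop1; congr (_ - _).
  by rewrite -[LHS]comp1op -N'N -compopA (compopA N F) NF -!compopA NN' compop1.
have UV : U ** V = I.
  rewrite /U /V compopDl !compopDr PF compopA compopBr compop1 PF subrr c0.
  rewrite addr0.
  rewrite -(compopA Q) NF compopA QF' c0 add0r VN' compopA -(compopA Q) NN'.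
  by rewrite compop1 compopBr QF' compop1 subr0 addrCA subrr addr0.
have F'P : F^** ** P = P by rewrite -{1}PP -adjopM PF PP.
have GP : (I - F) ** N' ** P = 0.
  by rewrite VN' -compopA compopBl comp1op F'P subrr comp0.
have GQN : (I - F) ** N' ** Q ** N = I - F.
  by rewrite compopBr compop1 GP subr0 -compopA N'N compop1.
have VU : V ** U = I.
  rewrite /U /V compopDl !compopDr FP !compopA FQ c0 addr0 GP GQN add0r.
  by rewrite addrC subrK.
have TE : T = U^** ** U.
  rewrite /U adjopD adjopM PP QQ NN compopDl (compopDr P) (compopDr (N ** Q)).
  rewrite P2 compopA PQ c0 addr0.
  by rewrite -compopA QP comp0 add0r compopA -(compopA N Q) Q2.
have UV' : V^** ** U^** = I by rewrite -adjopM UV adjop1.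
have VU' : U^** ** V^** = I by rewrite -adjopM VU adjop1.
split; last first.
  rewrite compopDl PF -!compopA NF (compopA Q) QF' c0.
  by rewrite comp0 addr0.
split; first split.
- by rewrite -/Q -/T TE adjopM adjopK.
- exists (V ** V^**); rewrite -/Q -/T TE; split.
  + by rewrite -compopA (compopA U) UV comp1op.
  + by rewrite -compopA (compopA V^**) UV' comp1op.
- move=> x; rewrite -/Q -/T TE.
  have -> : inner x ((U^** ** U) x) = inner (U x) (U x) by rewrite opadjP.
  exact: inner_ge0.
Qed.

End WeightedInverse.

(** * Passage to positive definite weights *)

Theorem theorem2p11 (R : realType) (AA : cstarAlgType R)
    (H K : hilbertModType AA) (M : 'L(K)) (N : 'L(H)) (A : 'L(H, K)) :
  weight M -> weight N -> has_wmpinv M N A ->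
  [/\ has_mpinv A,
      positive_definite (Tweight A N),
      op_invertible (Sweight_inv A M) /\ positive_definite (Sweight A M),
      has_wmpinv (Sweight A M) (Tweight A N) A &
      wmpinv M N A = wmpinv (Sweight A M) (Tweight A N) A].
Proof.
move=> Mw Nw [X AX]; have [AXA XAX MAX NXA] := AX.
have mpA : has_mpinv A := regular_has_mpinv AXA.
have [] := is_wmpinv_wmpinv mpA; rewrite -/(mpinv A) !comp1op.
set D := mpinv A => ADA DAD AD DA.
have [] := @compressed_weight _ _ _ N (D ** A) (X ** A) => //.
- by rewrite compopA DAD.
- by rewrite -compopA (compopA A) AXA.
- by rewrite -compopA (compopA A) ADA.
- by rewrite compopA.
rewrite -/(Tweight A N) => Tpd TF.
(* Both [A ** D] and [(A ** X)^**] have the kernel of A^*. *)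
have [] := @compressed_weight _ _ _ (opinv M) (A ** D) (A ** X)^** => //.
- exact: weight_opinv.
- by rewrite compopA ADA.
- by rewrite -{1}AD -adjopM compopA AXA AD.
- by rewrite -{1}AD -adjopM compopA ADA.
- by apply: weight_opinv_adj => //; rewrite compopA.
rewrite -/(Sweight_inv A M) => Spd SF.
have SX : is_wmpinv (Sweight A M) (Tweight A N) A X.
  split=> //; last by rewrite -compopA TF.
  have [Sw _] := positive_definite_opinv Spd.
  have [SS' S'S] := opinvP Spd.1.2; rewrite -/(Sweight A M) in Sw SS' S'S.
  (* The adjoint of [SF]. With S = [Sweight A M] it gives SAX = S(AD)S, which is self-adjoint. *)
  have QS : A ** X ** Sweight_inv A M = A ** D.
    by rewrite -AD -SF adjopM adjopK Spd.1.1.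
  have QE : A ** X = A ** D ** Sweight A M by rewrite -QS -compopA SS' compop1.
  rewrite -compopA QE; move: (A ** D) AD => E EE.
  by rewrite adjopM (adjopM E) EE Sw.1 compopA.
have Spd' := positive_definite_opinv Spd.
split=> //; first by split => //; exact: Spd.1.2.
  by exists X.
by rewrite (wmpinvE Mw Nw AX) (wmpinvE Spd'.1 Tpd.1 SX).
Qed.
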